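(* Let $\mathcal{A} = \{A_i = u_i v_i^T\}_{i=1}^n$ be any collection of rank-one real square matrices (all of the same size $d \times d$, with $u_i, v_i \in \mathbb{R}^d$), and let $p \in \Delta_n$ be any probability distribution on $\{1,\dots,n\}$. Then the Lyapunov exponent of $(\mathcal{A},p)$ satisfies $$\lambda(\mathcal{A},p) = \sum_{i,j=1}^n p_i p_j \log |u_i^T v_j|.$$
   Context: $\Delta_n := \{p \in \mathbb{R}_{\geq 0}^n : \sum_{i=1}^n p_i = 1\}$ is the set of probability distributions on $\{1,\dots,n\}$. For a finite collection $\mathcal{A}=\{A_1,\dots,A_n\}$ of real square matrices of the same size and $p\in\Delta_n$, the Lyapunov exponent is $$\lambda(\mathcal{A},p) := \lim_{k\to\infty} \frac1k\, \mathbb{E} \log \|A_{\sigma_k}\cdots A_{\sigma_2}A_{\sigma_1}\|,$$ where $\sigma_1,\sigma_2,\dots$ are i.i.d. with distribution $p$; the definition does not depend on the choice of matrix norm $\|\cdot\|$. Logarithms are natural. Conventions: $\log 0 = -\infty$ and $0\cdot(-\infty)=0$, so both sides may equal $-\infty$. *)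

(* Defs.v *)
From HB Require Import structures.
From mathcomp Require Import all_boot all_order all_algebra.
From mathcomp Require Import all_classical all_reals all_analysis.

Set Implicit Arguments.
Unset Strict Implicit.
Unset Printing Implicit Defensive.

Import Order.TTheory GRing.Theory Num.Theory.
Import numFieldNormedType.Exports.

Local Open Scope classical_set_scope.
Local Open Scope ring_scope.

Definition prob_simplex (R : realType) (n : nat) (p : 'I_n -> R) : Prop :=
  (forall i, 0 <= p i) /\ \sum_(i < n) p i = 1.

(* An arbitrary norm on the vector space of d x d matrices; submultiplicativity
   is not required. *)
Record is_matrix_norm (R : realType) (d : nat) (N : 'M[R]_d -> R) : Prop := {
  matrix_norm_eq0 : forall M, N M = 0 -> M = 0;
  matrix_normZ : forall (a : R) M, N (a *: M) = `|a| * N M;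
  matrix_normD : forall M1 M2, N (M1 + M2) <= N M1 + N M2 }.

(* The finite state space 'I_n carries the discrete sigma-algebra, so every
   B : set 'I_n is an event of the state space. *)
Record is_iid (R : realType) (disp : measure_display) (T : measurableType disp)
    (P : probability T R) (n : nat) (p : 'I_n -> R) (sigma : nat -> T -> 'I_n)
    : Prop := {
  iid_measurable : forall t (B : set 'I_n), measurable (sigma t @^-1` B);
  iid_law : forall t i, P (sigma t @^-1` [set i]) = (p i)%:E;
  iid_independent : forall (J : seq nat) (B : nat -> set 'I_n), uniq J ->
    P (\bigcap_(t in [set` J]) sigma t @^-1` B t) =
    (\prod_(t <- J) P (sigma t @^-1` B t))%E }.

(* A_{s (k-1)} *m ... *m A_{s 1} *m A_{s 0}: time is indexed from 0. *)
Fixpoint word_product (R : realType) (d n : nat) (A : 'I_n -> 'M[R]_d)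
    (s : nat -> 'I_n) (k : nat) : 'M[R]_d :=
  if k is k'.+1 then A (s k') *m word_product A s k' else 1%:M.

(* (1/k) E log ||A_{sigma_(k-1)} ... A_{sigma_0}||.  The expectation is written
   as an integral because 'E_P[X] is restricted to real-valued X, whereas
   the logarithm here may be -oo; lne 0 = -oo and 0 * -oo = 0. *)
Definition mean_log_growth (R : realType) (disp : measure_display)
    (T : measurableType disp) (P : probability T R) (d n : nat)
    (N : 'M[R]_d -> R) (A : 'I_n -> 'M[R]_d) (sigma : nat -> T -> 'I_n)
    (k : nat) : \bar R :=
  ((k%:R^-1)%:E *
    \int[P]_w lne (N (word_product A (fun t => sigma t w) k))%:E)%E.

Definition lyapunov_exponent (R : realType) (disp : measure_display)
    (T : measurableType disp) (P : probability T R) (d n : nat)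
    (N : 'M[R]_d -> R) (A : 'I_n -> 'M[R]_d) (sigma : nat -> T -> 'I_n)
    : \bar R :=
  limn (mean_log_growth P N A sigma).

(* Main.v *)
Require Import Defs.
From HB Require Import structures.
From mathcomp Require Import all_boot all_order all_algebra.
From mathcomp Require Import all_classical all_reals all_analysis.
From mathcomp Require Import measurable_realfun.
From mathcomp Require Import ring.

Set Implicit Arguments.
Unset Strict Implicit.
Unset Printing Implicit Defensive.

Import Order.TTheory GRing.Theory Num.Theory.
Import numFieldNormedType.Exports.

Local Open Scope classical_set_scope.
Local Open Scope ring_scope.

(** A product of rank-one matrices telescopes: between two consecutive factors
    [u_i v_i^T] only the number [v_j^T u_i] survives, so the product along a
    word [s] of length [k.+1] is a product of [k] scalars times the single
    matrix [u_(s k) v_(s 0)^T] ([word_product_rank1]).  Homogeneity of the norm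
    and the logarithm turn this into a sum of [k] terms
    [log |u_(s t)^T v_(s t.+1)|] plus a boundary term
    [log N (u_(s k) v_(s 0)^T)].  The letters are i.i.d., so each of the [k]
    terms has the same mean [m], the right-hand side of the theorem
    ([integral_iid_pair]).  As soon as [0 < k], the boundary term also involves
    two independent letters, so its mean [g] does not depend on [k]; it is
    finite because no [u_i] or [v_i] vanishes.  Hence the growth at time
    [k.+1] is exactly [(k m + g) / k.+1], which tends to [m]
    ([cvg_affine_mean]).

    The value [m] may be [-oo], so expectations cannot be handled through
    integrability.  Instead every integrand is a function of finitely many
    letters, its integral is a finite weighted sum ([integral_discrete]), and
    linearity ([integral_sum_discrete]) is a rearrangement of such sums, valid
    in the extended reals because the logarithm of a real number is never
    [+oo]. *)

(** * Integration of finitely-valued random variables *)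

Lemma measurable_fun_discrete (R : realType) (disp : measure_display)
    (T : measurableType disp) (I : finType) (X : T -> I)
    (f : I -> \bar R) :
  (forall i, measurable (X @^-1` [set i])) ->
  measurable_fun [set: T] (fun w => f (X w)).
Proof.
move=> mX _ Y mY; rewrite setTI.
rewrite (_ : _ @^-1` Y = \bigcup_(i in f @^-1` Y) X @^-1` [set i]).
  by apply: fin_bigcup_measurable => //; exact: finite_finset.
by apply/seteqP; split=> [w Yw|w [i /= Yi ->]] //; exists (X w).
Qed.

Lemma ge0_integral_discrete (R : realType) (disp : measure_display)
    (T : measurableType disp) (P : probability T R) (I : finType) (X : T -> I)
    (f : I -> \bar R) :
  (forall i, measurable (X @^-1` [set i])) -> (forall i, 0 <= f i)%E ->
  (\int[P]_w f (X w) = \sum_i P (X @^-1` [set i]) * f i)%E.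
Proof.
move=> mX f0.
have XT : \big[setU/set0]_(i <- index_enum I) (X @^-1` [set i]) = [set: T].
  rewrite -bigcup_seq -subTset => w _; exists (X w) => //=.
  exact: mem_index_enum.
rewrite -[in LHS]XT ge0_integral_bigsetU //=.
- apply: eq_bigr => i _; rewrite muleC -integral_cst//.
  by apply: eq_integral => w; rewrite inE => /= ->.
- exact: index_enum_uniq.
- by move=> i j _ _ [w [/= <- <-]].
- by rewrite XT; exact: measurable_fun_discrete.
Qed.

(** The positive and negative parts of [f] are summed separately; the integral
    is their difference by definition, so infinite values of [f] of either sign
    meet the same convention [+oo - oo = -oo] on both sides. *)
Lemma integral_discrete (R : realType) (disp : measure_display)
    (T : measurableType disp) (P : probability T R) (I : finType) (X : T -> I)
    (f : I -> \bar R) :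
  (forall i, measurable (X @^-1` [set i])) ->
  (\int[P]_w f (X w) = \sum_i P (X @^-1` [set i]) * f i)%E.
Proof.
move=> mX; rewrite integralE.
rewrite (_ : (fun w => f (X w))^\+%E = fun w => (f^\+)%E (X w)); last first.
  by apply/funext => w; rewrite !funeposE.
rewrite (_ : (fun w => f (X w))^\-%E = fun w => (f^\-)%E (X w)); last first.
  by apply/funext => w; rewrite !funenegE.
rewrite !ge0_integral_discrete//.
rewrite -sumeN; last first.
  by move=> i j _ _; apply: ge0_adde_def; rewrite inE mule_ge0.
rewrite -big_split/=; apply: eq_bigr => i _.
rewrite -muleN -muleDr ?fin_num_measure//; last exact: add_def_funeposneg.
by congr (_ * _)%E; rewrite [in RHS](funeposneg f).
Qed.

(** Linearity holds for functions that take the value [-oo] with positive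
    probability; excluding [+oo] rules out indeterminate sums. *)
Lemma integral_sum_discrete (R : realType) (disp : measure_display)
    (T : measurableType disp) (P : probability T R) (I : finType) (X : T -> I)
    (J : Type) (r : seq J) (f : J -> I -> \bar R) :
  (forall i, measurable (X @^-1` [set i])) -> (forall j i, f j i != +oo%E) ->
  (\int[P]_w (\sum_(j <- r) f j (X w)) =
   \sum_(j <- r) \int[P]_w f j (X w))%E.
Proof.
move=> mX fy.
rewrite (integral_discrete P (fun i => \sum_(j <- r) f j i)%E mX).
under [in RHS]eq_bigr do rewrite integral_discrete//.
rewrite exchange_big/=; apply: eq_bigr => i _.
rewrite fin_num_sume_distrr ?fin_num_measure// => j k _ _.
by rewrite /adde_def !negb_and !fy orbT.
Qed.

(** * Extended logarithms of products *)

(** Vanishing factors are covered because [lne 0 = -oo] absorbs every summand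
    coming from a real number. *)
Lemma lne_mul_ge0 (R : realType) (x y : R) : 0 <= x -> 0 <= y ->
  lne (x * y)%:E = (lne x%:E + lne y%:E)%E.
Proof.
rewrite !le_eqVlt => /predU1P[<-|x0] /predU1P[<-|y0].
- by rewrite mul0r le0_lneNy.
- by rewrite mul0r [in LHS]le0_lneNy// [lne 0%:E]le0_lneNy// lne_EFin.
- by rewrite mulr0 [in LHS]le0_lneNy// [lne 0%:E]le0_lneNy// lne_EFin.
- by rewrite EFinM lneM// in_itv/= lte_fin ?x0 ?y0 leey.
Qed.

Lemma lne_prod_ge0 (R : realType) (I : Type) (r : seq I) (F : I -> R) :
  (forall i, 0 <= F i) ->
  lne (\prod_(i <- r) F i)%:E = (\sum_(i <- r) lne (F i)%:E)%E.
Proof.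
move=> F0; elim: r => [|i r IH]; first by rewrite !big_nil lne1.
by rewrite !big_cons lne_mul_ge0 ?IH// prodr_ge0.
Qed.

Lemma lne_EFin_neqy (R : realType) (x : R) : lne x%:E != +oo%E.
Proof. by rewrite /lne; case: ifP. Qed.

(** * Products and norms of rank-one matrices *)

(** Each new factor [u_j v_j^T] meets [u_i] on its right, and [v_j^T u_i] is a
    1 x 1 block that moves out as a scalar. *)
Lemma word_product_rank1 (R : realType) (d n : nat) (u v : 'I_n -> 'cV[R]_d)
    (A : 'I_n -> 'M[R]_d) (s : nat -> 'I_n) (k : nat) :
  (forall i, A i = u i *m (v i)^T) ->
  word_product A s k.+1 =
    (\prod_(0 <= t < k) ((u (s t))^T *m v (s t.+1)) ord0 ord0) *:
      (u (s k) *m (v (s 0%N))^T).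
Proof.
move=> AE; elim: k => [|k IH]; first by rewrite /= mulmx1 big_geq// scale1r AE.
rewrite (_ : word_product A s k.+2 = A (s k.+1) *m word_product A s k.+1)//.
rewrite IH AE big_nat_recr//.
rewrite -scalemxAr -mulmxA [(v (s k.+1))^T *m _]mulmxA.
rewrite [_ *m u (s k)]mx11_scalar mul_scalar_mx -scalemxAr scalerA.
congr (_ * _ *: _); rewrite !mxE; apply: eq_bigr => i _.
by rewrite !mxE mulrC.
Qed.

(** Nonnegativity follows from [0 = N (M - M) <= 2 N M]. *)
Lemma matrix_norm_ge0 (R : realType) (d : nat) (N : 'M[R]_d -> R) :
  is_matrix_norm N -> forall M, 0 <= N M.
Proof.
move=> [_ NZ ND] M; have := ND M (- M).
have -> : N (- M) = N M by rewrite -scaleN1r NZ normrN1 mul1r.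
by rewrite subrr -[X in N X](scale0r M) NZ normr0 mul0r -mulr2n pmulrn_lge0.
Qed.

Lemma outer_product_eq0 (R : idomainType) (m n : nat)
    (x : 'cV[R]_m) (y : 'cV[R]_n) : (x *m y^T == 0) = (x == 0) || (y == 0).
Proof.
apply/eqP/orP => [/matrixP xy0|[]/eqP->]; last 2 first.
- by rewrite mul0mx.
- by rewrite trmx0 mulmx0.
have [/eqP|/cV0Pn[i xi]] := boolP (x == 0); first by left; apply/eqP.
right; apply/eqP/colP => j; have := xy0 i j.
rewrite !mxE big_ord1 !mxE => /eqP; rewrite mulf_eq0 (negPf xi)/=.
by move=> /eqP.
Qed.

(** * Averages over i.i.d. letters *)

Lemma integral_iid_pair (R : realType) (disp : measure_display)
    (T : measurableType disp) (P : probability T R) (n : nat) (p : 'I_n -> R)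
    (sigma : nat -> T -> 'I_n) (f : 'I_n -> 'I_n -> \bar R) (s t : nat) :
  is_iid P p sigma -> s != t ->
  (\int[P]_w f (sigma s w) (sigma t w) =
   \sum_(i < n) \sum_(j < n) (p i * p j)%:E * f i j)%E.
Proof.
move=> [msigma law indep] st.
have pairE i j : (fun w => (sigma s w, sigma t w)) @^-1` [set (i, j)] =
    sigma s @^-1` [set i] `&` sigma t @^-1` [set j].
  by apply/seteqP; split=> w /= [-> ->].
rewrite (integral_discrete P (X := fun w => (sigma s w, sigma t w))
  (fun x => f x.1 x.2)) => [|[i j]]; last first.
  by rewrite pairE; apply: measurableI.
rewrite pair_bigA/=; apply: eq_bigr => -[i j] _ /=; congr (_ * _)%E.
rewrite pairE.
(* Independence is a product rule over arbitrary lists of times; it is applied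
   to [:: s; t], with the two events selected by the time. *)
have -> : sigma s @^-1` [set i] `&` sigma t @^-1` [set j] =
    \bigcap_(r in [set` [:: s; t]])
      sigma r @^-1` (if r == s then [set i] else [set j]).
  apply/seteqP; split=> [w /= [wi wj] r /=|w wst].
    by rewrite !inE => /orP[] /eqP->; rewrite ?eqxx// eq_sym (negPf st).
  split; first by have := wst s; rewrite /= eqxx => ->//; exact: mem_head.
  by have := wst t; rewrite /= eq_sym (negPf st) => ->//; rewrite !inE eqxx orbT.
rewrite (indep _ (fun r => if r == s then [set i] else [set j])); last first.
  by rewrite /= inE st.
by rewrite !big_cons big_nil mule1 eqxx eq_sym (negPf st) !law.
Qed.

Lemma measurable_prefix (disp : measure_display) (T : measurableType disp)
    (I : finType) (sigma : nat -> T -> I) (k : nat) (x : {ffun 'I_k -> I}) :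
  (forall t i, measurable (sigma t @^-1` [set i])) ->
  measurable ((fun w => [ffun t : 'I_k => sigma t w]) @^-1` [set x]).
Proof.
move=> msigma.
rewrite (_ : _ @^-1` _ = \bigcap_(t in [set: 'I_k]) sigma t @^-1` [set x t]).
  by apply: fin_bigcap_measurable => //; exact: finite_finset.
apply/seteqP; split=> w /= => [<- t _|wx]; first by rewrite /= ffunE.
by apply/ffunP => t; rewrite ffunE; exact: wx.
Qed.

(** The term [G] closes the path [sigma 0, ..., sigma k.+1] into a cycle.  At
    least one step is taken, so the endpoints are distinct times and [G] too is
    averaged against the product law; this makes its mean independent of [k]. *)
Lemma integral_iid_path_sum (R : realType) (disp : measure_display)
    (T : measurableType disp) (P : probability T R) (n : nat) (p : 'I_n -> R)
    (sigma : nat -> T -> 'I_n) (L G : 'I_n -> 'I_n -> \bar R) (k : nat) :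
  is_iid P p sigma ->
  (forall i j, L i j != +oo%E) -> (forall i j, G i j != +oo%E) ->
  (\int[P]_w (\sum_(0 <= t < k.+1) L (sigma t w) (sigma t.+1 w) +
     G (sigma k.+1 w) (sigma 0%N w)) =
   (\sum_(i < n) \sum_(j < n) (p i * p j)%:E * L i j) *+ k.+1 +
   \sum_(i < n) \sum_(j < n) (p i * p j)%:E * G i j)%E.
Proof.
move=> iid Ly Gy.
(* All summands are functions of the prefix [X]; [None] indexes the closing
   term and [Some t] the step from time [t] to time [t.+1]. *)
pose X w := [ffun t : 'I_k.+2 => sigma t w].
pose F (o : option 'I_k.+1) (x : {ffun 'I_k.+2 -> 'I_n}) := if o is Some t
  then L (x (widen_ord (leqnSn _) t)) (x (lift ord0 t))
  else G (x ord_max) (x ord0).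
have FE w : (\sum_(0 <= t < k.+1) L (sigma t w) (sigma t.+1 w) +
     G (sigma k.+1 w) (sigma 0%N w) =
     \sum_(o <- None :: [seq Some t | t <- index_enum 'I_k.+1]) F o (X w))%E.
  rewrite big_mkord [in RHS]big_cons big_map addeC; congr (_ + _)%E.
    by rewrite /F !ffunE.
  by apply: eq_bigr => t _; rewrite /F !ffunE.
under eq_integral do rewrite FE.
rewrite (integral_sum_discrete P _ (X := X) (f := F)); first last.
- by case=> [t|] x; rewrite /F.
- by move=> x; apply: measurable_prefix => t i; exact: iid_measurable iid t _.
rewrite big_cons big_map addeC; congr (_ + _)%E.
  transitivity
      (\sum_(t < k.+1) \sum_(i < n) \sum_(j < n) (p i * p j)%:E * L i j)%E.
    apply: eq_bigr => t _.
    rewrite -(@integral_iid_pair _ _ _ _ _ _ _ L t t.+1 iid).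
      by apply: eq_integral => w _; rewrite /F !ffunE.
    by rewrite neq_ltn ltnSn.
  elim: k.+1 => [|l IH]; first by rewrite big_ord0.
  by rewrite big_ord_recl IH muleS.
rewrite -(@integral_iid_pair _ _ _ _ _ _ _ G k.+1 0%N iid)//.
by apply: eq_integral => w _; rewrite /F !ffunE.
Qed.

(** * The limit *)

Lemma cvg_affine_mean (R : realType) (m : \bar R) (g : R) : m != +oo%E ->
  ((k.+2%:R^-1)%:E * (m *+ k.+1 + g%:E))%E @[k --> \oo] --> m.
Proof.
case: m => [m|//|] _; last first.
  apply: cvg_near_cst; apply: nearW => k.
  by rewrite enatmul_ninfty// addNye gt0_muleNy// lte_fin invr_gt0.
(* (k.+1 m + g) / k.+2 = m + (g - m) / k.+2. *)
rewrite (_ : (fun k => _) =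
    EFin \o (fun k => m + (g - m) * harmonic k.+1)).
  apply: cvg_EFin; first exact: nearW.
  rewrite -[X in _ --> X]addr0 -(mulr0 (g - m)).
  apply: cvgD; first exact: cvg_cst.
  apply: cvgMr.
  by have := @cvg_harmonic R; rewrite -cvg_shiftS.
apply/funext => k; rewrite -EFin_natmul -EFinD -EFinM [RHS]/=; congr EFin.
rewrite -mulr_natr -[in LHS](natr1 k.+1) -[in RHS](natr1 k.+1).
have k0 : k.+1%:R + 1 != 0 :> R by rewrite natr1 pnatr_eq0.
by field.
Qed.

Theorem theorem2p1 (R : realType) (d n : nat)
  (u v : 'I_n -> 'cV[R]_d) (A : 'I_n -> 'M[R]_d)
  (A_def : forall i, A i = u i *m (v i)^T)
  (A_rank1 : forall i, \rank (A i) = 1%N)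
  (p : 'I_n -> R) (p_simplex : prob_simplex p)
  (N : 'M[R]_d -> R) (N_norm : is_matrix_norm N)
  (disp : measure_display) (T : measurableType disp) (P : probability T R)
  (sigma : nat -> T -> 'I_n) (sigma_iid : is_iid P p sigma) :
  cvgn (mean_log_growth P N A sigma) /\
  lyapunov_exponent P N A sigma =
    (\sum_(i < n) \sum_(j < n)
       (p i * p j)%:E * lne (`|((u i)^T *m v j) ord0 ord0|%:E))%E.
Proof.
pose L i j := lne (`|((u i)^T *m v j) ord0 ord0|%:E).
pose g i j := ln (N (u i *m (v j)^T)).
have uv_neq0 i : (u i != 0) && (v i != 0).
  rewrite -negb_or -outer_product_eq0 -A_def -mxrank_eq0.
  by rewrite A_rank1.
have gE i j : lne (N (u i *m (v j)^T))%:E = (g i j)%:E.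
  rewrite lne_EFin// lt_neqAle matrix_norm_ge0// andbT eq_sym.
  apply/eqP => /(matrix_norm_eq0 N_norm)/eqP; rewrite outer_product_eq0.
  have /andP[/negPf-> _] := uv_neq0 i.
  by have /andP[_ /negPf->] := uv_neq0 j.
set m := (\sum_(i < n) _)%E.
have my : m != +oo%E.
  rewrite -ltey; apply: lte_sum_pinfty => i _.
  apply: lte_sum_pinfty => j _.
  rewrite ltey; have := lne_EFin_neqy `|((u i)^T *m v j) ord0 ord0|.
  have : 0 <= p i * p j by rewrite mulr_ge0// p_simplex.1.
  rewrite le_eqVlt => /predU1P[<-|pij]; first by rewrite mul0e.
  by case: (lne _) => // _; rewrite gt0_muleNy.
have growthE k : mean_log_growth P N A sigma k.+2 = ((k.+2%:R^-1)%:E *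
    (m *+ k.+1 + (\sum_(i < n) \sum_(j < n) p i * p j * g i j)%:E))%E.
  rewrite /mean_log_growth; congr (_ * _)%E.
  transitivity (\int[P]_w (\sum_(0 <= t < k.+1) L (sigma t w) (sigma t.+1 w) +
     (g (sigma k.+1 w) (sigma 0%N w))%:E))%E.
    apply: eq_integral => w _; rewrite (word_product_rank1 _ _ A_def).
    rewrite (matrix_normZ N_norm) normr_prod.
    rewrite lne_mul_ge0 ?matrix_norm_ge0 ?prodr_ge0// lne_prod_ge0//.
    by rewrite gE.
  rewrite (integral_iid_path_sum (L := L) (G := fun i j => (g i j)%:E) _
    sigma_iid)//.
    congr (_ + _)%E; rewrite -sumEFin; apply: eq_bigr => i _.
    by rewrite -sumEFin; apply: eq_bigr => j _; rewrite [RHS]EFinM.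
  by move=> i j; exact: lne_EFin_neqy.
have cvg_m : mean_log_growth P N A sigma @ \oo --> m.
  (* The formula needs a word of length at least 2: with a single letter the
     boundary term is read at equal times. *)
  rewrite -(cvg_shiftn 2).
  under eq_fun do rewrite addn2 growthE.
  exact: cvg_affine_mean.
split; first by apply/cvg_ex; exists m.
exact: cvg_lim.
Qed.
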